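(* Let $(V,\mu)$ and $(E,\tau)$ be positive measure spaces with $0<\mu(V)<\infty$. Let $K:V\times E\to[0,\infty)$ be measurable and satisfy both $\int_V K(v,e)\,d\mu(v)=1$ for $\tau$-a.e. $e\in E$ and $\int_E K(v,e)\,d\tau(e)=1$ for $\mu$-a.e. $v\in V$, and let $T$ be the integral operator $Tg(v)=\int_E K(v,e)g(e)\,d\tau(e)$. Then, for every $1\le p<\infty$ and every nonnegative $g\in L^p(E,\tau)$, \[ \mu(V)^{\frac1p-1}\|g\|_1\le\|Tg\|_p\le\|g\|_p . \] Moreover, $T$ is an $L^p$-contraction for arbitrary $g\in L^p(E,\tau)$, i.e. $\|Tg\|_p\le\|g\|_p$ for every (not necessarily nonnegative) $g\in L^p(E,\tau)$. For $p>1$ and nonnegative $g\in L^p(E,\tau)$, equality in the lower bound, $\|Tg\|_p=\mu(V)^{\frac1p-1}\|g\|_1$, holds if and only if $Tg=\frac{\|g\|_1}{\mu(V)}$ $\mu$-a.e.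
   Context: A positive measure space is a measure space equipped with a positive measure. Functions and kernels are assumed measurable whenever required (kernels on $V\times E$ with respect to the product), and all stated integrals are assumed to be well defined. $\|g\|_p$ denotes the norm in $L^p(E,\tau)$, $\|g\|_1$ the norm in $L^1(E,\tau)$, and $\|Tg\|_p$ the norm in $L^p(V,\mu)$. A kernel $K$ (and its operator $T$) satisfying both normalization conditions is called doubly stochastic. *)

(* Defs.v *)
From HB Require Import structures.
From mathcomp Require Export all_boot all_order all_algebra.
From mathcomp Require Export all_classical all_reals all_analysis.

Set Implicit Arguments.
Unset Strict Implicit.
Unset Printing Implicit Defensive.

Import Order.TTheory GRing.Theory Num.Theory.

Local Open Scope classical_set_scope.
Local Open Scope ring_scope.
Local Open Scope ereal_scope.

Definition doubly_stochastic (R : realType) (dV dE : measure_display)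
    (V : measurableType dV) (E : measurableType dE)
    (mu : {measure set V -> \bar R}) (tau : {measure set E -> \bar R})
    (K : V * E -> R) : Prop :=
  {ae tau, forall e, \int[mu]_v (K (v, e))%:E = 1} /\
  {ae mu, forall v, \int[tau]_e (K (v, e))%:E = 1}.

(* Extended-real valued because, for a signed g, the integral may be undefined
   on a mu-negligible set of points v; at every v where the integrand is not
   integrable the library integral is infinite (+oo - +oo evaluates to -oo), so
   finiteness of a norm of [intop tau K g] cannot come from a junk value. *)
Definition intop (R : realType) (dV dE : measure_display)
    (V : measurableType dV) (E : measurableType dE)
    (tau : {measure set E -> \bar R}) (K : V * E -> R) (g : E -> R) (v : V)
    : \bar R :=
  \int[tau]_e (K (v, e) * g e)%:E.

(* Main.v *)
(** The tangent line inequality [p c^(p-1) x <= x^p + (p-1) c^p], strict for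
    [p > 1] and [x <> c], carries all the convexity.  Integrated against
    [K(v, .) tau] at [c = Tg(v)] it gives [(Tg)^p <= T(g^p)] pointwise, and
    Tonelli turns this into the contraction; signed [g] reduce to [|g|].
    Integrated against [mu] at the mean [c] of [Tg], which Tonelli evaluates to
    [||g||_1 / mu(V)], it gives the lower bound, and strictness gives the
    equality case.

    [tau] need not be sigma-finite, but [{g <> 0}] is sigma-finite for [g] in
    [L^p], which is all that Tonelli requires. *)

Require Import Defs.
From HB Require Import structures.
From mathcomp Require Import measurable_realfun ring lra.

Set Implicit Arguments.
Unset Strict Implicit.
Unset Printing Implicit Defensive.

Import Order.TTheory GRing.Theory Num.Theory.

Local Open Scope classical_set_scope.
Local Open Scope ring_scope.
Local Open Scope ereal_scope.

(** * The tangent line inequality for real powers *)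

Section powR_tangent.
Context (R : realType).
Implicit Types (p c x t : R).
Local Open Scope ring_scope.

(** For p = 1 and c = 0 the factor c^(p-1) is 1, but the factor c still makes the right side
    vanish. *)
Lemma powR_subr1 p c : 0 < p -> 0 <= c -> c `^ p = c * c `^ (p - 1).
Proof.
move=> p0 c0; have [->|cn0] := eqVneq c 0.
  by rewrite powR0 ?mul0r ?gt_eqF.
by rewrite -[X in X * _](powRr1 c0) -powRD ?subrKC// cn0 implybT.
Qed.

Lemma powR_bernoulli p t : 1 < p -> 0 <= t -> t != 1 ->
  p * t < t `^ p + (p - 1).
Proof.
move=> p1 t0 t1; have p0 : 0 < p by lra.
have [->|tn0] := eqVneq t 0; first by rewrite mulr0 powR0 ?gt_eqF//; lra.
have tgt0 : 0 < t by rewrite lt_neqAle eq_sym tn0.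
have s0 : ln t != 0 by rewrite ln_eq0.
(* With s = ln t, dividing by t turns the claim into
   p < e^((p-1)s) + (p-1) e^(-s), where 1 + x <= e^x applies to both terms. *)
have e1 : 1 - ln t < t^-1.
  have := @expR_gt1Dx _ (- ln t); rewrite oppr_eq0 s0 => /(_ isT).
  by rewrite expRN lnK.
have e2 : 1 + (p - 1) * ln t <= t `^ (p - 1).
  by rewrite /powR (negbTE tn0); exact: expR_ge1Dx.
rewrite (powR_subr1 p0 t0).
rewrite (_ : _ + (p - 1) = t * (t `^ (p - 1) + (p - 1) * t^-1)); last by field.
rewrite [p * t]mulrC ltr_pM2l//.
have : (p - 1) * (1 - ln t) < (p - 1) * t^-1 by rewrite ltr_pM2l// subr_gt0.
lra.
Qed.

(** By homogeneity this is [powR_bernoulli] at t = x / c, multiplied by c^p. For c = 0, where no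
    ratio exists, the left side vanishes because p - 1 > 0. *)
Lemma powR_tangent_lt p c x : 1 < p -> 0 <= c -> 0 <= x -> x != c ->
  p * (c `^ (p - 1) * x) < x `^ p + (p - 1) * c `^ p.
Proof.
move=> p1 c0 x0 xc; have p0 : 0 < p by lra.
have [c00|cn0] := eqVneq c 0.
  rewrite c00 !powR0 ?gt_eqF ?subr_gt0// mul0r !mulr0 addr0 powR_gt0//.
  by rewrite lt_neqAle x0 eq_sym -c00 xc.
have cgt0 : 0 < c by rewrite lt_neqAle eq_sym cn0.
have t1 : x / c != 1 by rewrite -(divff cn0) (inj_eq (mulIf _))// invr_neq0.
have := powR_bernoulli p1 (divr_ge0 x0 c0) t1.
rewrite -(ltr_pM2r (powR_gt0 p cgt0)) mulrDl -powRM ?divr_ge0//.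
rewrite divfK//; congr (_ < _).
by rewrite (powR_subr1 p0 c0); field.
Qed.

Lemma powR_tangent p c x : 1 <= p -> 0 <= c -> 0 <= x ->
  p * (c `^ (p - 1) * x) <= x `^ p + (p - 1) * c `^ p.
Proof.
move=> p1 c0 x0; have [<-|pn1] := eqVneq 1 p.
  (* For p = 1 both sides equal x, since c^0 = 1 even at c = 0. *)
  by rewrite subrr powRr0 !mul1r mul0r addr0 powRr1.
have {pn1}p1 : 1 < p by rewrite lt_neqAle pn1.
have [->|xc] := eqVneq x c; last exact/ltW/powR_tangent_lt.
by rewrite (powR_subr1 (lt_trans ltr01 p1) c0); lra.
Qed.

End powR_tangent.

(** * Tonelli's theorem for integrands supported on a sigma-finite set *)

Section tonelli_sigma_finite_support.
Context (R : realType) (dV dE : measure_display)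
  (V : measurableType dV) (E : measurableType dE).
Variables (mu : {measure set V -> \bar R}) (tau : {measure set E -> \bar R}).
Variable S : set E.
Hypothesis mu_fin : mu [set: V] < +oo.
Hypothesis mS : measurable S.
Hypothesis tauS : sigma_finite S tau.

(** Restricted to [S], [tau] becomes sigma-finite on all of [E], while integrals of functions
    vanishing off [S] do not change. Tonelli's theorem is applied to this restriction. *)
Let tS : set E -> \bar R := mrestr tau mS.
HB.instance Definition _ := Measure.on tS.

Let tS_sigma_finite : sigma_finite [set: E] tS.
Proof.
have [F SF mF] := tauS.
(* The pieces of [S] are enlarged by the complement of [S], a null set for [tS], so that they cover
   [E]. *)
exists (fun n => F n `|` ~` S).
  by rewrite bigcupUl -?SF ?setUv//; exists 0%N.
move=> n; split.
  by apply: measurableU; [exact: (mF n).1|exact: measurableC].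
rewrite /tS/= /mrestr setIUl setICl setU0.
rewrite (le_lt_trans _ (mF n).2)// le_measure ?inE//.
  by apply: measurableI => //; exact: (mF n).1.
exact: (mF n).1.
Qed.

HB.instance Definition _ :=
  @Measure_isSigmaFinite.Build _ E R tS tS_sigma_finite.

(** Restricting to the full set does not change [mu]; it serves to carry the finite measure
    structure given by [mu_fin]. *)
Let mu' : set V -> \bar R := mfrestr measurableT mu_fin.
HB.instance Definition _ := FiniteMeasure.on mu'.

Let integral_tS (f : E -> \bar R) : (forall e, ~ S e -> f e = 0) ->
  \int[tau]_e f e = \int[tS]_e f e.
Proof.
move=> fS.
have fE : f = f \_ S.
  by apply/funext => e; rewrite patchE; case: ifPn => //;
    rewrite notin_setE => /fS.
rewrite fE -!integral_mkcond; apply: eq_measure_integral => A mA AS.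
by rewrite -[RHS]/(tau (A `&` S)) setIidl.
Qed.

Let integral_mu' (f : V -> \bar R) : \int[mu]_v f v = \int[mu']_v f v.
Proof.
by apply: eq_measure_integral => A mA _; rewrite -[RHS]/(mu (A `&` setT)) setIT.
Qed.

Variable F : V * E -> \bar R.
Hypothesis mF : measurable_fun setT F.
Hypothesis F_supp : forall v e, ~ S e -> F (v, e) = 0.

Lemma tonelli_support : (forall x, 0 <= F x) ->
  \int[mu]_v \int[tau]_e F (v, e) = \int[tau]_e \int[mu]_v F (v, e).
Proof.
move=> F0; rewrite integral_mu' integral_tS; last first.
  by move=> e Se; apply: integral0_eq => v _; exact: F_supp.
under eq_integral do rewrite (integral_tS (@F_supp _)).
under [RHS]eq_integral do rewrite integral_mu'.
exact: fubini_tonelli.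
Qed.

Lemma measurable_fun_integral_finite_measure : (forall x, 0 <= F x) ->
  measurable_fun [set: E] (fun e => \int[mu]_v F (v, e)).
Proof.
move=> F0; under eq_fun do rewrite integral_mu'.
exact: (@measurable_fun_fubini_tonelli_G _ _ _ _ _ mu' F).
Qed.

(** Here [F] may be signed, so its positive and negative parts go through Tonelli separately. The
    difference is measurable even where both integrals are infinite. *)
Lemma measurable_fun_integral_support :
  measurable_fun [set: V] (fun v => \int[tau]_e F (v, e)).
Proof.
under eq_fun do rewrite (integral_tS (@F_supp _)).
under eq_fun do rewrite integralE.
apply: emeasurable_funB.
- rewrite (_ : (fun v => _) = fubini_F tS F^\+); last first.
    by apply/funext => v; apply: eq_integral => e _; rewrite !funeposE.
  by apply: measurable_fun_fubini_tonelli_F => //; exact: measurable_funepos.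
- rewrite (_ : (fun v => _) = fubini_F tS F^\-); last first.
    by apply/funext => v; apply: eq_integral => e _; rewrite !funenegE.
  by apply: measurable_fun_fubini_tonelli_F => //; exact: measurable_funeneg.
Qed.

End tonelli_sigma_finite_support.

(** * Weighted Jensen inequality for powers *)

Section jensen_powR.
Context (R : realType) (d : measure_display) (T : measurableType d).
Variables (nu : {measure set T -> \bar R}) (w f : T -> R) (p : R).
Hypothesis p_ge1 : (1 <= p)%R.
Hypothesis mw : measurable_fun [set: T] w.
Hypothesis mf : measurable_fun [set: T] f.
Hypothesis w_ge0 : forall x, (0 <= w x)%R.
Hypothesis f_ge0 : forall x, (0 <= f x)%R.

(** The constant term of the tangent line stays on the right, so that all integrands are nonnegative
    and the integrals may be infinite. The weight [w] is K(v, .) in the contraction and the constant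
    1 in the lower bound. *)
Lemma integral_powR_tangent (c : R) : (0 <= c)%R ->
  (p * c `^ (p - 1))%:E * \int[nu]_x (w x * f x)%:E <=
  \int[nu]_x (w x * f x `^ p)%:E + ((p - 1) * c `^ p)%:E * \int[nu]_x (w x)%:E.
Proof.
move=> c0.
have p1 := p_ge1.
have a0 : (0 <= p * c `^ (p - 1))%R by rewrite mulr_ge0 ?powR_ge0//; lra.
have b0 : (0 <= (p - 1) * c `^ p)%R by rewrite mulr_ge0 ?powR_ge0//; lra.
have mfp : measurable_fun [set: T] (fun x => f x `^ p)%R.
  exact: (measurableT_comp (measurable_powR _)).
have mwf : measurable_fun [set: T] (fun x => (w x * f x)%:E).
  by apply/measurable_EFinP; exact: measurable_funM.
have mwfp : measurable_fun [set: T] (fun x => (w x * f x `^ p)%:E).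
  by apply/measurable_EFinP; exact: measurable_funM.
have mwE : measurable_fun [set: T] (fun x => (w x)%:E).
  exact/measurable_EFinP.
rewrite -!ge0_integralZl_EFin//; last 2 first.
- by move=> x _; rewrite lee_fin.
- by move=> x _; rewrite lee_fin mulr_ge0.
rewrite -ge0_integralD//; last 3 first.
- by move=> x _; rewrite lee_fin mulr_ge0// powR_ge0.
- by move=> x _; rewrite -EFinM lee_fin mulr_ge0.
- exact: measurable_funeM.
apply: ge0_le_integral => //.
- by move=> x _; rewrite -EFinM lee_fin mulr_ge0// mulr_ge0.
- exact: measurable_funeM.
- by apply: emeasurable_funD => //; exact: measurable_funeM.
- move=> x _; rewrite -!EFinM -EFinD lee_fin.
  have := ler_wpM2l (w_ge0 x) (powR_tangent p_ge1 c0 (f_ge0 x)).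
  lra.
Qed.

Lemma jensen_powR : \int[nu]_x (w x)%:E = 1 ->
  (\int[nu]_x (w x * f x)%:E) `^ p <= \int[nu]_x (w x * f x `^ p)%:E.
Proof.
move=> w1; have p1 := p_ge1; have p0 : (0 < p)%R by lra.
have I0 : 0 <= \int[nu]_x (w x * f x)%:E.
  by apply: integral_ge0 => x _; rewrite lee_fin mulr_ge0.
case IE : (\int[nu]_x (w x * f x)%:E) I0 => [c| |//] c0.
- rewrite poweR_EFin; rewrite lee_fin in c0.
  have := integral_powR_tangent c0.
  rewrite w1 IE mule1 -EFinM -leeBlDr// -EFinB.
  apply: le_trans; rewrite lee_fin.
  by rewrite (powR_subr1 p0 c0); lra.
(* If the mean is infinite, the tangent at 1 already forces the right-hand side to be infinite. *)
- have := integral_powR_tangent ler01.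
  rewrite w1 IE !powR1 !mulr1 mule1 gt0_muley ?lte_fin// leye_eq.
  by case: (\int[nu]_x _) => //= ; rewrite leey.
Qed.

End jensen_powR.

(** * The power mean inequality on a finite measure space *)

Section power_mean.
Context (R : realType) (d : measure_display) (T : measurableType d).
Variable mu : {measure set T -> \bar R}.
Variables (p M : R).
Hypothesis p_ge1 : (1 <= p)%R.
Hypothesis M_gt0 : (0 < M)%R.
Hypothesis muT : mu [set: T] = M%:E.

Lemma power_mean (f : T -> R) (J : R) : measurable_fun [set: T] f ->
  (forall x, (0 <= f x)%R) -> \int[mu]_x (f x `^ p)%:E = J%:E ->
  exists I : R, [/\ \int[mu]_x (f x)%:E = I%:E, (0 <= I)%R,
    (M * (I / M) `^ p <= J)%R &
    (1 < p)%R -> J = (M * (I / M) `^ p)%R ->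
    {ae mu, forall x, f x = (I / M)%R}].
Proof.
move=> mf f0 fJ; have p1 := p_ge1; have M0 := M_gt0.
have tangent (c : R) : (0 <= c)%R ->
    (p * c `^ (p - 1))%:E * \int[mu]_x (f x)%:E <=
    (J + (p - 1) * c `^ p * M)%:E.
  move=> c0; have m1 : measurable_fun [set: T] (cst 1%R : T -> R) by [].
  have := integral_powR_tangent mu p1 m1 mf (fun=> ler01) f0 c0.
  under eq_integral do rewrite mul1r.
  under [X in _ <= X + _]eq_integral do rewrite mul1r.
  by rewrite fJ (integral_cst mu measurableT 1)//= mul1e muT -EFinM -EFinD.
have I0 : 0 <= \int[mu]_x (f x)%:E.
  by apply: integral_ge0 => x _; rewrite lee_fin.
(* The tangent at 1 bounds p times this integral by J + (p-1) M. *)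
have : \int[mu]_x (f x)%:E < +oo.
  case: (\int[mu]_x (f x)%:E) (tangent 1%R ler01) => [r _|/=|//].
    exact: ltry.
  by rewrite powR1 mulr1 gt0_muley ?leye_eq// lte_fin; lra.
case IE : (\int[mu]_x (f x)%:E) I0 => [I| |]// I0 _; rewrite lee_fin in I0.
set m := (I / M)%R; have m0 : (0 <= m)%R by rewrite divr_ge0// ltW.
have IM : I = (m * M)%R by rewrite divfK// gt_eqF.
have mp : (m `^ p = m * m `^ (p - 1))%R by rewrite powR_subr1//; lra.
exists I; rewrite -/m; split => //.
  have := tangent m m0; rewrite IE -EFinM lee_fin IM mp; lra.
move=> pgt1 JE.
(* [phi] is the gap in the tangent inequality at the mean [m]. In the equality case its integral is
   0, so it vanishes a.e., and strictness forces f = m there. *)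
pose phi x := (f x `^ p + (p - 1) * m `^ p - p * (m `^ (p - 1) * f x))%R.
have phi0 x : (0 <= phi x)%R by rewrite subr_ge0; exact: powR_tangent.
have mfp : measurable_fun [set: T] (fun x => f x `^ p)%R.
  exact: (measurableT_comp (measurable_powR _)).
have mphi : measurable_fun [set: T] phi.
  apply: measurable_funB; first exact: measurable_funD.
  by apply: measurable_funM => //; exact: measurable_funM.
have b0 : (0 <= (p - 1) * m `^ p)%R by rewrite mulr_ge0 ?powR_ge0//; lra.
have a0 : (0 <= p * m `^ (p - 1))%R by rewrite mulr_ge0 ?powR_ge0//; lra.
(* The additive form needs linearity for nonnegative integrands only; subtraction takes place once
   the integral of [phi] is known to be real. *)
have phiE : \int[mu]_x (phi x)%:E + (p * m `^ (p - 1))%:E * I%:E =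
    J%:E + ((p - 1) * m `^ p * M)%:E.
  rewrite -fJ [in RHS](EFinM _ M) -muT -integral_cst// -IE.
  rewrite -ge0_integralZl_EFin//; last 2 first.
  - by move=> x _; rewrite lee_fin.
  - exact/measurable_EFinP.
  rewrite -!ge0_integralD//.
  - by apply: eq_integral => x _; rewrite -EFinM -!EFinD /phi; congr EFin; lra.
  - by move=> x _; rewrite lee_fin powR_ge0.
  - exact/measurable_EFinP.
  - by move=> x _; rewrite lee_fin.
  - exact/measurable_EFinP.
  - by move=> x _; rewrite -EFinM lee_fin mulr_ge0.
  - by apply: measurable_funeM; exact/measurable_EFinP.
have iphi : \int[mu]_x `|(phi x)%:E| = 0.
  under eq_integral do rewrite gee0_abs ?lee_fin//.
  have : 0 <= \int[mu]_x (phi x)%:E.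
    by apply: integral_ge0 => x _; rewrite lee_fin.
  case: (\int[mu]_x (phi x)%:E) phiE => //= r; rewrite -!EFinM -!EFinD => -[].
  move=> rE _; congr EFin; move: rE; rewrite JE IM mp; lra.
have mphiE : measurable_fun [set: T] (fun x => (phi x)%:E).
  exact/measurable_EFinP.
have := (ae_eq_integral_abs mu measurableT mphiE).1 iphi.
apply: filterS => x /(_ Logic.I) /= [] phix.
apply/eqP; apply: contraPT phix => fm.
apply/eqP; rewrite gt_eqF// subr_gt0; exact: powR_tangent_lt.
Qed.

Variable h : T -> \bar R.
Hypothesis mh : measurable_fun [set: T] h.
Hypothesis h_ge0 : forall x, 0 <= h x.
Hypothesis h_fin : 'N[mu]_p%:E[h] < +oo.

(** A finite norm makes h^p integrable, so [h] is finite a.e. and [power_mean] applies to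
    [fine (h x)]. The converse in the equality case is the integration of a constant. *)
Let power_mean_ereal : exists I J : R,
  [/\ \int[mu]_x h x = I%:E, 'N[mu]_p%:E[h] = (J `^ p^-1)%:E,
      (0 <= I)%R /\ (0 <= J)%R, (M * (I / M) `^ p <= J)%R &
      (1 < p)%R ->
      (J = (M * (I / M) `^ p)%R <-> {ae mu, forall x, h x = (I / M)%:E})].
Proof.
have p1 := p_ge1; have M0 := M_gt0; have p0 : (0 < p)%R by lra.
have mhp : measurable_fun [set: T] (fun x => h x `^ p).
  by apply: (measurableT_comp (measurable_poweR _)).
have NE : 'N[mu]_p%:E[h] = (\int[mu]_x h x `^ p) `^ p^-1.
  by rewrite unlock; under eq_integral do rewrite gee0_abs//.
have hpJ : \int[mu]_x h x `^ p < +oo.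
  by move: h_fin; rewrite NE; apply: lty_poweRy; rewrite invr_neq0// gt_eqF.
have hfin : {ae mu, forall x, h x = (fine (h x))%:E}.
  have : mu.-integrable [set: T] (fun x => h x `^ p).
    apply/integrableP; split => //.
    by under eq_integral do rewrite gee0_abs ?poweR_ge0//.
  move=> /(integrable_ae measurableT); apply: filterS => x /(_ Logic.I).
  rewrite ge0_fin_numE ?poweR_ge0// => hx; rewrite fineK// ge0_fin_numE//.
  by apply: lty_poweRy hx; rewrite gt_eqF.
pose f x := fine (h x).
have mf : measurable_fun [set: T] f by exact: measurableT_comp.
have f0 x : (0 <= f x)%R by rewrite fine_ge0.
have hf : \int[mu]_x h x = \int[mu]_x (f x)%:E.
  apply: ae_eq_integral => //; first exact/measurable_EFinP.
  by apply: filterS hfin.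
have hfp : \int[mu]_x h x `^ p = \int[mu]_x (f x `^ p)%:E.
  apply: ae_eq_integral => //.
    apply/measurable_EFinP; exact: (measurableT_comp (measurable_powR _)).
  by apply: filterS hfin => x {1}-> _; rewrite poweR_EFin.
have J0 : 0 <= \int[mu]_x h x `^ p.
  by apply: integral_ge0 => x _; rewrite poweR_ge0.
case JE : (\int[mu]_x h x `^ p) hpJ J0 => [J| |]// _ J0; rewrite lee_fin in J0.
have fJ := JE; rewrite hfp in fJ.
have [I [fI I0 IJ Ieq]] := power_mean mf f0 fJ.
exists I, J; split => //; first by rewrite hf.
- by rewrite NE JE poweR_EFin.
- move=> pgt1; split => [/(Ieq pgt1) fE|hE].
    by apply: filterS2 hfin fE => x -> <-.
  apply/EFin_inj; rewrite -JE EFinM muleC -muT -integral_cst//.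
  apply: ae_eq_integral => //; apply: filterS hE => x -> _.
  by rewrite poweR_EFin.
Qed.

(** The p-th root turns the bound M (I/M)^p <= J into one with the normalization mu(V)^(1/p-1). *)
Let mean_powRV (I : R) : (0 <= I)%R ->
  ((M * (I / M) `^ p) `^ p^-1 = M `^ (p^-1 - 1) * I)%R.
Proof.
move=> I0; have p1 := p_ge1; have M0 := M_gt0; have p0 : (0 < p)%R by lra.
have m0 : (0 <= I / M)%R by rewrite divr_ge0// ltW.
rewrite powRM ?powR_ge0 ?ltW// -powRrM mulfV ?gt_eqF// powRr1//.
rewrite powRB ?(gt_eqF M0) ?implybT// powRr1 ?ltW//; field.
by rewrite gt_eqF.
Qed.

Lemma Lnorm_ge_mean :
  mu [set: T] `^ (p^-1 - 1) * \int[mu]_x h x <= 'N[mu]_p%:E[h].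
Proof.
have [I [J [-> -> [I0 J0] IJ _]]] := power_mean_ereal.
rewrite muT poweR_EFin -EFinM lee_fin -mean_powRV//.
have p1 := p_ge1; have M0 := M_gt0.
apply: ge0_ler_powR => //; rewrite ?nnegrE ?invr_ge0 ?mulr_ge0 ?powR_ge0 ?ltW//.
lra.
Qed.

Lemma Lnorm_eq_mean : (1 < p)%R ->
  'N[mu]_p%:E[h] = mu [set: T] `^ (p^-1 - 1) * \int[mu]_x h x <->
  {ae mu, forall x, h x = \int[mu]_x h x / mu [set: T]}.
Proof.
move=> pgt1; have M0 := M_gt0; have p0 : (0 < p)%R by lra.
have [I [J [-> -> [I0 J0] IJ /(_ pgt1) Ieq]]] := power_mean_ereal.
rewrite muT poweR_EFin -EFinM inver gt_eqF// -EFinM -mean_powRV//.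
rewrite -Ieq; split => [[]|->//].
(* Both sides are p-th roots of nonnegative reals, so raising to the power p recovers their
   radicands. *)
move/(congr1 (fun x => x `^ p)%R); rewrite -!powRrM mulVf ?gt_eqF// !powRr1//.
by rewrite mulr_ge0 ?powR_ge0// ltW.
Qed.

End power_mean.

(** * Sigma-finiteness of the support of an L^p function *)

Lemma sigma_finite_support (R : realType) (d : measure_display)
    (T : measurableType d) (nu : {measure set T -> \bar R}) (g : T -> R)
    (p : R) :
  (0 < p)%R -> measurable_fun [set: T] g ->
  \int[nu]_x (`|g x| `^ p)%:E < +oo -> sigma_finite [set x | g x != 0%R] nu.
Proof.
move=> p0 mg gfin; pose f x := (`|g x| `^ p)%:E.
have mf : measurable_fun [set: T] f.
  apply/measurable_EFinP; apply: (measurableT_comp (measurable_powR _)).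
  exact: measurableT_comp.
have f0 x : 0 <= f x by rewrite lee_fin powR_ge0.
have a0 n : (0 < n.+1%:R^-1 :> R)%R by rewrite invr_gt0.
(* The level sets |g|^p >= 1/(n+1) exhaust the support, and Markov's inequality makes each of finite
   measure. *)
exists (fun n => [set: T] `&` [set x | n.+1%:R^-1%:E <= `|f x|]).
  apply/seteqP; split => [x /= gx|x [n _ [_]]].
    have fx : (0 < `|g x| `^ p)%R by rewrite powR_gt0// normr_gt0.
    (* With this n, n + 1 exceeds 1/|g x|^p. *)
    exists (Num.truncn (`|g x| `^ p)^-1) => //; split => //.
    rewrite /= lee_fin (ger0_norm (powR_ge0 _ _)) invf_ple ?posrE//.
    by apply/ltW/truncnS_gt.
  rewrite /= lee_fin (ger0_norm (powR_ge0 _ _)) => nf; apply/negP => /eqP gx0.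
  by move: nf; rewrite gx0 normr0 powR0 ?gt_eqF// leNgt a0.
move=> n; split.
  by apply: emeasurable_fun_c_infty => //; exact: measurableT_comp.
have := le_integral_abse nu measurableT mf (a0 n).
rewrite [X in _ <= X](_ : _ = \int[nu]_x f x); last first.
  by apply: eq_integral => x _; exact: gee0_abs.
move=> /le_lt_trans /(_ gfin).
case: (nu _) => [r|/=|]//; first by move=> _; exact: ltry.
by rewrite gt0_muley ?lte_fin.
Qed.

(** * The operator of a doubly stochastic kernel *)

Section doubly_stochastic_operator.
Context (R : realType) (dV dE : measure_display)
  (V : measurableType dV) (E : measurableType dE).
Variables (mu : {measure set V -> \bar R}) (tau : {measure set E -> \bar R}).
Variable K : V * E -> R.
Hypothesis mu_fin : mu [set: V] < +oo.
Hypothesis mK : measurable_fun [set: V * E] K.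
Hypothesis K_ge0 : forall v e, (0 <= K (v, e))%R.
Hypothesis dsK : doubly_stochastic mu tau K.

Let mKv v : measurable_fun [set: E] (fun e => K (v, e)).
Proof. exact: measurable_fun_pair2. Qed.

Let mKg (g : E -> R) : measurable_fun [set: E] g ->
  measurable_fun [set: V * E] (fun x => (K x * g x.2)%:E).
Proof.
move=> mg; apply/measurable_EFinP; apply: measurable_funM => //.
exact: measurableT_comp.
Qed.

Let mKvg v (g : E -> R) : measurable_fun [set: E] g ->
  measurable_fun [set: E] (fun e => (K (v, e) * g e)%:E).
Proof. by move=> mg; apply/measurable_EFinP; exact: measurable_funM. Qed.

Let msupp (g : E -> R) : measurable_fun [set: E] g ->
  measurable [set e | g e != 0%R].
Proof.
move=> mg; have := mg measurableT [set~ 0%R] (measurableC (measurable_set1 _)).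
by rewrite setTI; congr measurable; apply/seteqP; split => e /= /eqP.
Qed.

Let Kg_supp (g : E -> R) v e : ~ [set e | g e != 0%R] e ->
  (K (v, e) * g e)%:E = 0.
Proof. by move=> /negP; rewrite negbK => /eqP ->; rewrite mulr0. Qed.

Lemma measurable_intop (g : E -> R) : measurable_fun [set: E] g ->
  sigma_finite [set e | g e != 0%R] tau ->
  measurable_fun [set: V] (intop tau K g).
Proof.
move=> mg sg.
exact: (measurable_fun_integral_support (msupp mg) sg (mKg mg) (@Kg_supp g)).
Qed.

Lemma intop_ge0 (g : E -> R) v :
  (forall e, (0 <= g e)%R) -> 0 <= intop tau K g v.
Proof. by move=> g0; apply: integral_ge0 => e _; rewrite lee_fin mulr_ge0. Qed.

(** After Tonelli, the inner integral of K(., e) over [V] is 1 by [dsK.1]. This holds only for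
    almost every e, so the integrands are compared a.e. *)
Lemma integral_intop (g : E -> R) : measurable_fun [set: E] g ->
  (forall e, (0 <= g e)%R) -> sigma_finite [set e | g e != 0%R] tau ->
  \int[mu]_v intop tau K g v = \int[tau]_e (g e)%:E.
Proof.
move=> mg g0 sg; rewrite /intop.
rewrite (tonelli_support mu_fin (msupp mg) sg (mKg mg) (@Kg_supp g));
  last by move=> [v e]; rewrite lee_fin mulr_ge0.
have E1 e :
    \int[mu]_v (K (v, e) * g e)%:E = (g e)%:E * \int[mu]_v (K (v, e))%:E.
  rewrite -ge0_integralZl_EFin//.
  - by apply: eq_integral => v _; rewrite -EFinM mulrC.
  - by move=> v _; rewrite lee_fin.
  - by apply/measurable_EFinP; exact: measurable_fun_pair1.
rewrite /=; apply: ge0_ae_eq_integral => //.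
- apply: (measurable_fun_integral_finite_measure mu_fin (mKg mg)).
  by move=> [v e]; rewrite lee_fin mulr_ge0.
- exact/measurable_EFinP.
- by move=> e _; apply: integral_ge0 => v _; rewrite lee_fin mulr_ge0.
- by move=> e _; rewrite lee_fin.
- by apply: filterS dsK.1 => e Ke _; rewrite E1 Ke mule1.
Qed.

Variable p : R.
Hypothesis p_ge1 : (1 <= p)%R.

Let Lfun_sigma_finite (g : E -> R) : g \in Lfun tau p%:E ->
  measurable_fun [set: E] g /\ sigma_finite [set e | g e != 0%R] tau.
Proof.
have p1 := p_ge1; have p0 : (0 < p)%R by lra.
rewrite inE => /andP[]; rewrite !inE/= => mg gfin; split => //.
apply: (sigma_finite_support p0 mg); move: gfin; rewrite /finite_norm unlock.
move/lty_poweRy; rewrite invr_neq0 ?gt_eqF// => /(_ isT).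
by congr (_ < _); apply: eq_integral.
Qed.

(** Each normalization enters once: [dsK.2] makes K(v, .) a probability density for Jensen, and
    [dsK.1] acts through [integral_intop] applied to g^p, which has the same support as g. *)
Lemma integral_intop_powR (g : E -> R) : measurable_fun [set: E] g ->
  (forall e, (0 <= g e)%R) -> sigma_finite [set e | g e != 0%R] tau ->
  \int[mu]_v intop tau K g v `^ p <= \int[tau]_e (g e `^ p)%:E.
Proof.
move=> mg g0 sg; have p1 := p_ge1; have p0 : (0 < p)%R by lra.
have mgp : measurable_fun [set: E] (fun e => g e `^ p)%R.
  exact: (measurableT_comp (measurable_powR _)).
have gp0 e : (0 <= g e `^ p)%R by exact: powR_ge0.
have sgp : sigma_finite [set e | (g e `^ p)%R != 0%R] tau.
  rewrite (_ : [set e | _] = [set e | g e != 0%R])//.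
  by apply/seteqP; split => e /=; rewrite powR_eq0 (gt_eqF p0) andbT.
rewrite -(integral_intop mgp gp0 sgp).
apply: ae_ge0_le_integral => //.
- by move=> v _; exact: poweR_ge0.
- apply: (measurableT_comp (measurable_poweR _)); exact: measurable_intop.
- by move=> v _; exact: intop_ge0.
- exact: measurable_intop.
- apply: filterS dsK.2 => v Kv _.
  exact: (jensen_powR p_ge1 (mKv v) mg (K_ge0 v) g0 Kv).
Qed.

Lemma Lnorm_intop_le (g : E -> R) : g \in Lfun tau p%:E ->
  'N[mu]_p%:E[intop tau K g] <= 'N[tau]_p%:E[EFin \o g].
Proof.
have p1 := p_ge1; have p0 : (0 < p)%R by lra.
move=> /Lfun_sigma_finite[mg sg].
rewrite unlock; apply: gt0_ler_poweR; rewrite ?invr_ge0 ?(ltW p0)//.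
- by rewrite in_itv/= leey andbT; apply: integral_ge0 => v _; exact: poweR_ge0.
- by rewrite in_itv/= leey andbT; apply: integral_ge0 => e _; exact: powR_ge0.
have mng : measurable_fun [set: E] (fun e => `|g e|%R).
  exact: measurableT_comp.
have sng : sigma_finite [set e | `|g e|%R != 0%R] tau.
  rewrite (_ : [set e | _] = [set e | g e != 0%R])//.
  by apply/seteqP; split => e /=; rewrite normr_eq0.
have := integral_intop_powR mng (fun=> normr_ge0 _) sng.
apply: le_trans.
apply: ge0_le_integral => //.
- by move=> v _; exact: poweR_ge0.
- apply: (measurableT_comp (measurable_poweR _)); apply: measurableT_comp => //.
  exact: measurable_intop.
- apply: (measurableT_comp (measurable_poweR _)); exact: measurable_intop.
- move=> v _; apply: gt0_ler_poweR; rewrite ?(ltW p0)//.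
  + by rewrite in_itv/= leey abse_ge0.
  + by rewrite in_itv/= leey intop_ge0.
  (* The bound |Tg| <= T|g| holds at every v: where K(v, .) g is not integrable, T|g|(v) is
     [+oo]. *)
  apply: (le_trans (le_abse_integral _ measurableT (mKvg v mg))).
  rewrite le_eqVlt; apply/orP; left; apply/eqP; apply: eq_integral => e _.
  by rewrite /= normrM ger0_norm.
Qed.

(** Replacing g by |g| changes it only on a [tau]-null set, which no integral over [E] sees. The
    equality therefore holds at every v, and lemmas for everywhere nonnegative functions become
    available. *)
Lemma intop_normr (g : E -> R) : measurable_fun [set: E] g ->
  {ae tau, forall e, (0 <= g e)%R} ->
  intop tau K g = intop tau K (fun e => `|g e|%R).
Proof.
move=> mg g0; apply/funext => v; apply: ae_eq_integral => //.
- exact: mKvg.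
- by apply: mKvg; exact: measurableT_comp.
- by apply: filterS g0 => e ge0 _; rewrite ger0_norm.
Qed.

(** These are the conditions that the power mean lemmas impose on h = Tg, together with the value of
    its integral; the finite norm comes from the contraction. *)
Lemma integral_intop_Lfun (g : E -> R) : g \in Lfun tau p%:E ->
  {ae tau, forall e, (0 <= g e)%R} ->
  [/\ measurable_fun [set: V] (intop tau K g),
      forall v, 0 <= intop tau K g v,
      'N[mu]_p%:E[intop tau K g] < +oo &
      \int[mu]_v intop tau K g v = 'N[tau]_1[EFin \o g]].
Proof.
move=> Lg g0; have [mg sg] := Lfun_sigma_finite Lg; split.
- exact: measurable_intop.
- by move=> v; rewrite intop_normr//; exact: intop_ge0.
- apply: le_lt_trans (Lnorm_intop_le Lg) _.
  by move: Lg; rewrite inE => /andP[_]; rewrite inE.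
- rewrite intop_normr// Lnorm1 integral_intop//.
  + exact: measurableT_comp.
  + rewrite (_ : [set e | _] = [set e | g e != 0%R])//.
    by apply/seteqP; split => e /=; rewrite normr_eq0.
Qed.

End doubly_stochastic_operator.

Theorem theorem2p1 (R : realType) (dV dE : measure_display)
    (V : measurableType dV) (E : measurableType dE)
    (mu : {measure set V -> \bar R}) (tau : {measure set E -> \bar R})
    (K : V * E -> R)
    (mu_gt0 : 0 < mu [set: V]) (mu_fin : mu [set: V] < +oo)
    (mK : measurable_fun [set: V * E] K)
    (K_ge0 : forall v e, (0 <= K (v, e))%R)
    (dsK : doubly_stochastic mu tau K)
    (p : R) (p_ge1 : (1 <= p)%R) :
  [/\ forall g : E -> R, g \in Lfun tau p%:E ->
        {ae tau, forall e, (0 <= g e)%R} ->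
        mu [set: V] `^ (p^-1 - 1) * 'N[tau]_1[EFin \o g]
          <= 'N[mu]_p%:E[intop tau K g]
        /\ 'N[mu]_p%:E[intop tau K g] <= 'N[tau]_p%:E[EFin \o g],
      forall g : E -> R, g \in Lfun tau p%:E ->
        'N[mu]_p%:E[intop tau K g] <= 'N[tau]_p%:E[EFin \o g]
    & (1 < p)%R ->
      forall g : E -> R, g \in Lfun tau p%:E ->
        {ae tau, forall e, (0 <= g e)%R} ->
        ('N[mu]_p%:E[intop tau K g]
           = mu [set: V] `^ (p^-1 - 1) * 'N[tau]_1[EFin \o g]
         <-> {ae mu, forall v,
               intop tau K g v = 'N[tau]_1[EFin \o g] / mu [set: V]})].
Proof.
have [M M0 muT] : exists2 M : R, (0 < M)%R & mu [set: V] = M%:E.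
  case: (mu [set: V]) mu_gt0 mu_fin => [M| |]// M0 _.
  by exists M => //; rewrite -lte_fin.
split=> [g Lg g0|g Lg|p1 g Lg g0].
- split; last exact: Lnorm_intop_le.
  (* Writing the L^1 norm of g as the integral of Tg leaves a statement about Tg alone. *)
  have [mh h0 hfin <-] := integral_intop_Lfun mu_fin mK K_ge0 dsK p_ge1 Lg g0.
  exact: (Lnorm_ge_mean p_ge1 M0 muT mh h0 hfin).
- exact: Lnorm_intop_le.
- have [mh h0 hfin <-] := integral_intop_Lfun mu_fin mK K_ge0 dsK p_ge1 Lg g0.
  exact: (Lnorm_eq_mean p_ge1 M0 muT mh h0 hfin p1).
Qed.
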